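(* There exist no totally umbilical or totally geodesic proper QGCR-lightlike submanifolds $(M,g,S(TM),S(TM^\perp))$ of an indefinite nearly Sasakian manifold $(\overline{M},\overline{\phi},\eta,\xi,\overline{g})$ with the structure vector field $\xi$ normal to $M$ (that is, $\xi\in\Gamma(TM^\perp)$ along $M$).
   Context: Notation: $\Gamma(\Xi)$ is the set of smooth sections of a vector bundle $\Xi$. Indefinite nearly Sasakian manifold: a $(2n+1)$-dimensional manifold $\overline{M}$ with a $(1,1)$-tensor $\overline{\phi}$, a vector field $\xi$, a 1-form $\eta$ and a semi-Riemannian metric $\overline{g}$ with Levi-Civita connection $\overline{\nabla}$ such that $\overline{\phi}^2=-I+\eta\otimes\xi$, $\eta(\xi)=1$, $\eta\circ\overline{\phi}=0$, $\overline{\phi}\xi=0$, $\overline{g}(\overline{\phi}X,\overline{\phi}Y)=\overline{g}(X,Y)-\eta(X)\eta(Y)$ (hence $\eta=\overline{g}(\xi,\cdot)$), and $(\overline{\nabla}_X\overline{\phi})Y+(\overline{\nabla}_Y\overline{\phi})X=2\overline{g}(X,Y)\xi-\eta(Y)X-\eta(X)Y$ for all $X,Y$. Lightlike submanifold: a submanifold $M$ of $\overline{M}$, with $g$ the induced (degenerate) metric, such that $\mathrm{Rad}\,TM=TM\cap TM^\perp$ is a smooth distribution of rank $r>0$, where $TM^\perp$ is the $\overline{g}$-orthogonal complement of $TM$ in $T\overline{M}|_M$. A screen distribution $S(TM)$ is a semi-Riemannian (non-degenerate) complement of $\mathrm{Rad}\,TM$ in $TM$; $S(TM^\perp)$ is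 a semi-Riemannian complement of $\mathrm{Rad}\,TM$ in $TM^\perp$. The lightlike transversal bundle $l\mathrm{tr}(TM)$ is locally spanned by null sections $N_i$ of the orthogonal complement of $S(TM^\perp)$ in $S(TM)^\perp$ with $\overline{g}(E_i,N_j)=\delta_{ij}$, $\overline g(N_i,N_j)=0$ for a local basis $\{E_i\}$ of $\mathrm{Rad}\,TM$. Put $\mathrm{tr}(TM)=l\mathrm{tr}(TM)\perp S(TM^\perp)$, so $T\overline{M}|_M=TM\oplus\mathrm{tr}(TM)$. The Gauss formula is $\overline{\nabla}_XY=\nabla_XY+h(X,Y)$ for $X,Y\in\Gamma(TM)$, with $\nabla_XY\in\Gamma(TM)$ and $h(X,Y)\in\Gamma(\mathrm{tr}(TM))$. $M$ is totally umbilical if there is a smooth $\mathcal{H}\in\Gamma(\mathrm{tr}(TM))$ with $h(X,Y)=\mathcal{H}g(X,Y)$ for all $X,Y\in\Gamma(TM)$; totally geodesic if $h=0$. QGCR-lightlike submanifold: a lightlike submanifold $(M,g,S(TM),S(TM^\perp))$ of $\overline{M}$ is Quasi Generalized Cauchy-Riemann (QGCR) if (i) there are distributions $D_1,D_2$ of $\mathrm{Rad}\,TM$ with $\mathrm{Rad}\,TM=D_1\oplus D_2$, $\overline{\phi}D_1=D_1$, $\overline{\phi}D_2\subset S(TM)$; (ii) there are subbundles $D_0,\overline{D}$ of $S(TM)$ with $S(TM)=\{\overline{\phi}D_2\oplus\overline{D}\}\perp D_0$, $\overline{\phi}D_0\subseteq D_0$, $\overline{D}=\overline{\phi}\mathcal{S}\oplus\overline{\phi}\mathcal{L}$,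 where $D_0$ is non-degenerate and $\mathcal{L}$, $\mathcal{S}$ are vector subbundles of $l\mathrm{tr}(TM)$ and $S(TM^\perp)$ respectively. In (ii) the symbol $\oplus$ denotes a (not necessarily orthogonal) sum of subbundles, and the summands $\overline{\phi}D_2$ and $\overline{\phi}\mathcal{L}$ are allowed to intersect. $M$ is proper if $D_0,D_1,D_2,\mathcal{S}$ are all nonzero. *)

(* Defs.v *)
From HB Require Import structures.
From mathcomp Require Import all_boot all_order all_algebra.
From mathcomp Require Import all_classical all_reals all_analysis.

Set Implicit Arguments.
Unset Strict Implicit.
Unset Printing Implicit Defensive.

Import Order.TTheory GRing.Theory Num.Theory.
Import numFieldNormedType.Exports.

Local Open Scope classical_set_scope.
Local Open Scope ring_scope.

(** * Smooth functions and smooth manifolds *)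

(* C^k on an open set V of R^n, by iterated partial derivatives. *)
Fixpoint Ck (R : realType) (n k : nat) (V : set 'rV[R]_n)
    (f : 'rV[R]_n -> R) : Prop :=
  (forall x, V x -> {for x, continuous f}) /\
  if k is k'.+1 then
    forall i : 'I_n, (forall x, V x -> derivable f x (delta_mx 0 i)) /\
                     Ck k' V (fun x => 'D_(delta_mx 0 i) f x)
  else True.

Definition smooth_at (R : realType) (n : nat) (x : 'rV[R]_n)
    (f : 'rV[R]_n -> R) : Prop :=
  exists2 V : set 'rV[R]_n, open_nbhs x V & forall k, Ck k V f.

Record chart (R : realType) (n : nat) (M : topologicalType) := Chart {
  cdom : set M;
  cimg : set 'rV[R]_n;
  cmap : M -> 'rV[R]_n;
  cinv : 'rV[R]_n -> M;
  cdom_open : open cdom;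
  cimg_open : open cimg;
  cmap_img : forall p, cdom p -> cimg (cmap p);
  cinv_dom : forall x, cimg x -> cdom (cinv x);
  cmapK : forall p, cdom p -> cinv (cmap p) = p;
  cinvK : forall x, cimg x -> cmap (cinv x) = x;
  cmap_continuous : forall p, cdom p -> {for p, continuous cmap};
  cinv_continuous : forall x, cimg x -> {for x, continuous cinv} }.

(* The atlas need not be maximal. *)
Record manifold (R : realType) (n : nat) := Manifold {
  carrier :> topologicalType;
  atlas : set (chart R n carrier);
  manifold_hausdorff : hausdorff_space carrier;
  manifold_second_countable : @second_countable carrier;
  atlas_cover : forall p, exists2 c, atlas c & cdom c p;
  atlas_smooth : forall c d, atlas c -> atlas d ->
    forall p, cdom c p -> cdom d p ->
    forall j : 'I_n, smooth_at (cmap c p) (fun x => cmap d (cinv c x) 0 j) }.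

(* Germs at [p] are represented by total functions, arbitrary away from [p]. *)
Definition smooth_near (R : realType) (n : nat) (M : manifold R n) (p : M)
    (f : M -> R) : Prop :=
  forall c, atlas c -> cdom c p -> smooth_at (cmap c p) (f \o cinv c).

(** * Tangent vectors and sections *)

(* Tangent vectors act on functions; [tvec M] is an ambient vector space      *)
(* containing all the tangent spaces of [M].                                  *)
Definition tvec (R : realType) (n : nat) (M : manifold R n) : lmodType R :=
  ((M -> R) -> R^o).

(* T_pM is spanned by the coordinate derivations at [p]. Making tangent       *)
(* vectors vanish on functions that are not smooth near [p] ensures that      *)
(* equality in [tvec M] is equality as derivations of germs.                  *)
Definition tangent (R : realType) (n : nat) (M : manifold R n) (p : M) :
    set (tvec M) :=
  [set v | exists c, [/\ atlas c, cdom c p & exists w : 'rV[R]_n,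
     v = (fun f => if `[< smooth_near p f >]
                   then 'D_w (f \o cinv c) (cmap c p) else 0)]].

Section Maps.
Context (R : realType) (n m : nat) (N : manifold R n) (M : manifold R m).
Implicit Types (F : M -> N) (p : M).

Definition smooth_map F : Prop :=
  forall p, {for p, continuous F} /\
    forall f, smooth_near (F p) f -> smooth_near p (f \o F).

Definition push F p (v : tvec M) : tvec N :=
  fun f => if `[< smooth_near (F p) f >] then v (f \o F) else 0.

Definition immersion F : Prop :=
  smooth_map F /\
  forall p u v, tangent p u -> tangent p v -> push F p u = push F p v -> u = v.

(* [Z] is, near [p], a smooth section of the pullback bundle F^*TN. *)
Definition section F p (Z : M -> tvec N) : Prop :=
  (\forall q \near p, tangent (F q) (Z q)) /\
  forall f, smooth_near (F p) f -> smooth_near p (fun q => Z q f).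

End Maps.

Definition vfield (R : realType) (n : nat) (M : manifold R n) (p : M)
    (X : M -> tvec M) : Prop := section (fun q : M => q) p X.

(** * Linear algebra and subbundles *)

Section Linear.
Context (R : realType) (V : lmodType R).
Implicit Types (A B : set V).

Definition is_frame (k : nat) (e : 'I_k -> V) A : Prop :=
  (forall a : 'I_k -> R, \sum_i a i *: e i = 0 -> forall i, a i = 0) /\
  A = [set v | exists a : 'I_k -> R, v = \sum_i a i *: e i].

Definition sumset A B : set V :=
  [set w | exists u v, [/\ A u, B v & w = u + v]].

Definition direct_sum A B C : Prop := A = sumset B C /\ B `&` C = [set 0].

Definition orthogonal (g : V -> V -> R) A B : Prop :=
  forall u v, A u -> B v -> g u v = 0.

Definition nondegenerate (g : V -> V -> R) A : Prop :=
  forall u, A u -> (forall v, A v -> g u v = 0) -> u = 0.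

(* e is an orthonormal basis of A with exactly nu timelike vectors *)
Definition has_index (g : V -> V -> R) (k nu : nat) A : Prop :=
  (nu <= k)%N /\ exists e : 'I_k -> V, is_frame e A /\
    forall i j, g (e i) (e j) = if i == j then (-1) ^+ (i < nu)%N else 0.

End Linear.

Section Bundles.
Context (R : realType) (n m : nat) (N : manifold R n) (M : manifold R m).
Implicit Types (F : M -> N) (A B C : M -> set (tvec N)).

(* [A] is a smooth vector subbundle of rank [k] of F^*TN. *)
Definition subbundle_rank F (k : nat) A : Prop :=
  forall p, exists E : 'I_k -> M -> tvec N,
    (forall i, section F p (E i)) /\
    \forall q \near p, is_frame (fun i => E i q) (A q).

Definition subbundle F A : Prop := exists k, subbundle_rank F k A.

Definition nonzero_bundle A : Prop := exists p v, A p v /\ v <> 0.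

(* [Z] is, near [p], a smooth section of the subbundle [A]. *)
Definition section_of F A (p : M) (Z : M -> tvec N) : Prop :=
  section F p Z /\ \forall q \near p, A q (Z q).

(* [D p v Z] is the covariant derivative at [p] of the section [Z] of F^*TN   *)
(* in the direction of [v] in T_pM. The Leibniz rule for germs of smooth      *)
(* functions makes it depend only on the germ of [Z] at [p].                  *)
Record connection_along F (D : M -> tvec M -> (M -> tvec N) -> tvec N) : Prop :=
  ConnectionAlong {
  conn_tangent : forall p v Z, tangent p v -> section F p Z ->
    tangent (F p) (D p v Z);
  conn_linear : forall p a u v Z, tangent p u -> tangent p v -> section F p Z ->
    D p (a *: u + v) Z = a *: D p u Z + D p v Z;
  conn_add : forall p v Y Z, tangent p v -> section F p Y -> section F p Z ->
    D p v (fun q => Y q + Z q) = D p v Y + D p v Z;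
  conn_leibniz : forall p v f Z, tangent p v -> smooth_near p f ->
    section F p Z ->
    D p v (fun q => f q *: Z q) = v f *: Z p + f p *: D p v Z;
  conn_smooth : forall p X Z, vfield p X -> section F p Z ->
    section F p (fun q => D q (X q) Z) }.

End Bundles.

(** * Semi-Riemannian metrics and nearly Sasakian structures *)

Section SemiRiemannian.
Context (R : realType) (n : nat) (M : manifold R n).

Record semi_riemannian (g : M -> tvec M -> tvec M -> R) : Prop :=
  SemiRiemannian {
  metric_sym : forall p u v, tangent p u -> tangent p v -> g p u v = g p v u;
  metric_linear : forall p a u v w,
    tangent p u -> tangent p v -> tangent p w ->
    g p (a *: u + v) w = a * g p u w + g p v w;
  metric_nondegenerate : forall p, nondegenerate (g p) (tangent p);
  metric_index : exists nu, forall p, has_index (g p) n nu (tangent p);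
  metric_smooth : forall p X Y, vfield p X -> vfield p Y ->
    smooth_near p (fun q => g q (X q) (Y q)) }.

Record levi_civita (g : M -> tvec M -> tvec M -> R)
    (nab : M -> tvec M -> (M -> tvec M) -> tvec M) : Prop := LeviCivita {
  lc_connection : connection_along (fun q : M => q) nab;
  lc_torsion_free : forall p X Y f, vfield p X -> vfield p Y ->
    smooth_near p f ->
    (nab p (X p) Y - nab p (Y p) X) f =
    X p (fun q => Y q f) - Y p (fun q => X q f);
  lc_metric : forall p v Y Z, tangent p v -> vfield p Y -> vfield p Z ->
    v (fun q => g q (Y q) (Z q)) = g p (nab p v Y) (Z p) + g p (Y p) (nab p v Z)
  }.

End SemiRiemannian.

Record nearly_sasakian (R : realType) (n : nat) := NearlySasakian {
  ns_manifold :> manifold R (2 * n + 1)%N;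
  phi : ns_manifold -> tvec ns_manifold -> tvec ns_manifold;
  xi : ns_manifold -> tvec ns_manifold;
  eta : ns_manifold -> tvec ns_manifold -> R;
  gbar : ns_manifold -> tvec ns_manifold -> tvec ns_manifold -> R;
  nabbar : ns_manifold -> tvec ns_manifold ->
    (ns_manifold -> tvec ns_manifold) -> tvec ns_manifold;
  gbar_metric : semi_riemannian gbar;
  nabbar_levi_civita : levi_civita gbar nabbar;
  phi_tangent : forall p v, tangent p v -> tangent p (phi p v);
  phi_linear : forall p a u v, tangent p u -> tangent p v ->
    phi p (a *: u + v) = a *: phi p u + phi p v;
  phi_smooth : forall p X, vfield p X -> vfield p (fun q => phi q (X q));
  xi_smooth : forall p, vfield p xi;
  eta_linear : forall p a u v, tangent p u -> tangent p v ->
    eta p (a *: u + v) = a * eta p u + eta p v;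
  eta_smooth : forall p X, vfield p X -> smooth_near p (fun q => eta q (X q));
  phi_sqr : forall p v, tangent p v ->
    phi p (phi p v) = - v + eta p v *: xi p;
  eta_xi : forall p, eta p (xi p) = 1;
  eta_phi : forall p v, tangent p v -> eta p (phi p v) = 0;
  phi_xi : forall p, phi p (xi p) = 0;
  gbar_phi : forall p u v, tangent p u -> tangent p v ->
    gbar p (phi p u) (phi p v) = gbar p u v - eta p u * eta p v;
  nearly_sasakian_eq : forall p X Y, vfield p X -> vfield p Y ->
    let cov_phi U W := (* (nabbar_U phi) W at p *)
      nabbar p (U p) (fun q => phi q (W q)) - phi p (nabbar p (U p) W) in
    cov_phi X Y + cov_phi Y X =
    (2 * gbar p (X p) (Y p)) *: xi p - eta p (Y p) *: X p - eta p (X p) *: Y p }.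

Arguments phi {R n} _ _ _.
Arguments xi {R n} _ _.
Arguments eta {R n} _ _ _.
Arguments gbar {R n} _ _ _ _.
Arguments nabbar {R n} _ _ _ _.

(** * Lightlike submanifolds *)

Section LightlikeNotions.
Context (R : realType) (n m : nat) (N : manifold R n) (M : manifold R m).
Context (g : N -> tvec N -> tvec N -> R) (F : M -> N).

(* All bundles over M are regarded as subbundles of F^*TN; in particular TM   *)
(* stands for its image under the differential of the immersion F.            *)
Definition TMb (p : M) : set (tvec N) := push F p @` tangent p.

Definition orth (A : M -> set (tvec N)) (p : M) : set (tvec N) :=
  [set v | tangent (F p) v /\ forall u, A p u -> g (F p) u v = 0].

Definition Rad (p : M) : set (tvec N) := TMb p `&` orth TMb p.

(* W is a lightlike transversal bundle ltr(TM), r being the rank of Rad TM. *)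
Definition lightlike_transversal (r : nat) (S Sp W : M -> set (tvec N)) : Prop :=
  forall p, exists E W' : 'I_r -> M -> tvec N,
    (forall i, section F p (E i) /\ section F p (W' i)) /\
    \forall q \near p,
      [/\ is_frame (fun i => E i q) (Rad q),
          is_frame (fun i => W' i q) (W q),
          forall i, orth S q (W' i q) /\ orth Sp q (W' i q)
        & forall i j, g (F q) (E i q) (W' j q) = (i == j)%:R /\
                      g (F q) (W' i q) (W' j q) = 0].

End LightlikeNotions.

Record lightlike_submanifold (R : realType) (n : nat)
    (Mb : nearly_sasakian R n) := LightlikeSubmanifold {
  dimM : nat;
  subm :> manifold R dimM;
  incl : subm -> Mb;
  incl_inj : injective incl;
  incl_immersion : immersion incl;
  rad_rank : nat;
  rad_rank_gt0 : (0 < rad_rank)%N;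
  rad_subbundle : subbundle_rank incl rad_rank (Rad (gbar Mb) incl);
  screen : subm -> set (tvec Mb);        (* S(TM) *)
  screen_perp : subm -> set (tvec Mb);   (* S(TM^perp) *)
  ltr : subm -> set (tvec Mb);           (* ltr(TM) *)
  screen_subbundle : subbundle incl screen;
  screen_nondegenerate : forall p, nondegenerate (gbar Mb (incl p)) (screen p);
  screen_compl : forall p,
    direct_sum (TMb incl p) (Rad (gbar Mb) incl p) (screen p);
  screen_perp_subbundle : subbundle incl screen_perp;
  screen_perp_nondegenerate : forall p,
    nondegenerate (gbar Mb (incl p)) (screen_perp p);
  screen_perp_compl : forall p,
    direct_sum (orth (gbar Mb) incl (TMb incl) p)
               (Rad (gbar Mb) incl p) (screen_perp p);
  ltrP : lightlike_transversal (gbar Mb) incl rad_rank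
           screen screen_perp ltr;
  (* nabbar along M: the pullback of the Levi-Civita connection, uniquely     *)
  (* determined by the two properties below.                                  *)
  nabbarM : subm -> tvec subm -> (subm -> tvec Mb) -> tvec Mb;
  nabbarM_connection : connection_along incl nabbarM;
  nabbarM_pullback : forall p v Y, tangent p v -> vfield (incl p) Y ->
    nabbarM p v (fun q => Y (incl q)) = nabbar Mb (incl p) (push incl p v) Y;
  (* Gauss formula, tr(TM) being ltr(TM) + S(TM^perp) *)
  nablaM : subm -> tvec subm -> (subm -> tvec Mb) -> tvec Mb;
  sff : subm -> tvec subm -> (subm -> tvec Mb) -> tvec Mb;
  gauss : forall p v Y, tangent p v -> section_of incl (TMb incl) p Y ->
    [/\ TMb incl p (nablaM p v Y),
        sumset (ltr p) (screen_perp p) (sff p v Y)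
      & nabbarM p v Y = nablaM p v Y + sff p v Y] }.

Arguments incl {R n Mb} _ _.
Arguments screen {R n Mb} _ _.
Arguments screen_perp {R n Mb} _ _.
Arguments ltr {R n Mb} _ _.
Arguments sff {R n Mb} _ _ _ _.

Section Submanifold.
Context (R : realType) (n : nat) (Mb : nearly_sasakian R n).
Context (M : lightlike_submanifold Mb).

Definition tr (p : M) : set (tvec Mb) := sumset (ltr M p) (screen_perp M p).

Definition totally_umbilical : Prop :=
  exists H : M -> tvec Mb,
    (forall p, section_of (incl M) tr p H) /\
    forall p v Y, tangent p v ->
      section_of (incl M) (TMb (incl M)) p Y ->
      sff M p v Y = gbar Mb (incl M p) (push (incl M) p v) (Y p) *: H p.

Definition totally_geodesic : Prop :=
  forall p v Y, tangent p v ->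
    section_of (incl M) (TMb (incl M)) p Y -> sff M p v Y = 0.

Definition xi_normal : Prop :=
  forall p, orth (gbar Mb) (incl M) (TMb (incl M)) p
              (xi Mb (incl M p)).

(* The sums in [qgcr_screen] and [qgcr_Dbar] are not required to be direct:   *)
(* phi D2 and phi L may intersect.                                            *)
Record qgcr := Qgcr {
  D0 : M -> set (tvec Mb);
  D1 : M -> set (tvec Mb);
  D2 : M -> set (tvec Mb);
  Dbar : M -> set (tvec Mb);
  Lb : M -> set (tvec Mb);
  Sb : M -> set (tvec Mb);
  qgcr_subbundles :
    [/\ subbundle (incl M) D0, subbundle (incl M) D1,
        subbundle (incl M) D2 & subbundle (incl M) Dbar] /\
    subbundle (incl M) Lb /\ subbundle (incl M) Sb;
  qgcr_rad : forall p, direct_sum (Rad (gbar Mb) (incl M) p)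
                         (D1 p) (D2 p);
  qgcr_phiD1 : forall p, phi Mb (incl M p) @` D1 p = D1 p;
  qgcr_phiD2 : forall p, phi Mb (incl M p) @` D2 p `<=` screen M p;
  qgcr_D0_sub : forall p, D0 p `<=` screen M p;
  qgcr_Dbar_sub : forall p, Dbar p `<=` screen M p;
  qgcr_screen : forall p,
    screen M p = sumset (sumset (phi Mb (incl M p) @` D2 p) (Dbar p)) (D0 p);
  qgcr_screen_orth : forall p, orthogonal (gbar Mb (incl M p))
    (sumset (phi Mb (incl M p) @` D2 p) (Dbar p)) (D0 p);
  qgcr_phiD0 : forall p, phi Mb (incl M p) @` D0 p `<=` D0 p;
  qgcr_D0_nondegenerate : forall p, nondegenerate (gbar Mb (incl M p)) (D0 p);
  qgcr_L_sub : forall p, Lb p `<=` ltr M p;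
  qgcr_S_sub : forall p, Sb p `<=` screen_perp M p;
  qgcr_Dbar : forall p,
    Dbar p = sumset (phi Mb (incl M p) @` Sb p) (phi Mb (incl M p) @` Lb p) }.

Definition qgcr_proper (Q : qgcr) : Prop :=
  [/\ nonzero_bundle (D0 Q), nonzero_bundle (D1 Q),
      nonzero_bundle (D2 Q) & nonzero_bundle (Sb Q)].

End Submanifold.

(* Main.v *)
From HB Require Import structures.
From mathcomp Require Import all_boot all_order all_algebra.
From mathcomp Require Import all_classical all_reals all_analysis.
From mathcomp Require Import lra.
Require Import Defs.

(* For a local section X of D0, the nearly Sasakian identity with both        *)
(* arguments equal to X, paired with xi, gives                                *)
(*   g(nabla_X (phi X), xi) = g(X, X) - eta(X)^2 = g(X, X),                   *)
(* because phi(nabla_X X) is orthogonal to xi and xi is normal to M. Since    *)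
(* phi X again lies in D0 and g(X, phi X) = 0, the Gauss formula of a totally *)
(* umbilical or totally geodesic M puts nabla_X (phi X) in TM, so the left    *)
(* side vanishes. Hence g is null on D0, which polarization turns into a      *)
(* contradiction with D0 being nondegenerate and nonzero.                     *)

Set Implicit Arguments.
Unset Strict Implicit.
Unset Printing Implicit Defensive.

Import Order.TTheory GRing.Theory Num.Theory.
Import numFieldNormedType.Exports.

Local Open Scope classical_set_scope.
Local Open Scope ring_scope.

(** * Differential calculus in R^n *)

(** On [D0] the nearly Sasakian equation and umbilicity make incompatible demands. Since [xi] is
    normal, [eta] vanishes on TM. For a section X of [D0], h(X, phi X) is zero or a multiple of g(X,
    phi X) = 0, so the derivative of phi X along X is tangent to M and [eta] kills it; the structure
    equation says that this [eta]-component is g(X, X). Hence [D0] consists of null vectors, which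
    is impossible for a nonzero nondegenerate bundle. The ambient computation is [eta_nabbar_phi],
    its transfer to M is [eta_nabbarM_phi], and [qgcr_D0_null] combines it with the Gauss formula.

    The analysis serves the transfer: a section along M is expanded in the coordinate frame of an
    ambient chart, with coefficients smooth on M. This expansion, [tangent_coordE], rests on the
    chain rule [derive_comp_row], applicable because C^1 functions are differentiable
    ([differentiable_partials]). Closure under composition ([smooth_at_comp]) makes smoothness
    independent of the chart, and [conn_near_eq] lets a connection differentiate a merely local
    expansion. *)

Lemma mean_value_estimate (R : realType) (g : R -> R) (L e r : R) :
  (forall s, `|s| <= r -> derivable g s 1 /\ `|'D_1 g s - L| <= e) ->
  forall t, `|t| <= r -> `|g t - g 0 - t * L| <= e * `|t|.
Proof.
move=> dg.
have mv a b : a <= b -> (forall s, s \in `[a, b] -> `|s| <= r) ->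
    `|g b - g a - (b - a) * L| <= e * (b - a).
  move=> ab abr.
  have [||c /abr /dg[_ gcL] ->] := @MVT_segment R g ('D_1 g) a b ab.
  - by move=> s /subset_itv_oo_cc /abr /dg[+ _] => /derivableP.
  - by apply: derivable_within_continuous => s /abr /dg[].
  rewrite [_ * (b - a)]mulrC -mulrBr normrM ger0_norm ?subr_ge0 // mulrC.
  by rewrite ler_wpM2r // subr_ge0.
(* The mean value theorem wants an ordered segment: [0, t] or [t, 0] according to the sign of
   [t]. *)
move=> t tr; have [t0|t0] := leP 0 t.
  have := mv 0 t t0; rewrite subr0 (ger0_norm t0); apply => s.
  rewrite in_itv /= => /andP[s0 st]; apply: le_trans tr.
  by rewrite !ger0_norm.
have := mv t 0 (ltW t0); rewrite sub0r (ltr0_norm t0) -normrN.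
rewrite (_ : - (_ - _ - _) = g t - g 0 - t * L); last by lra.
apply => s; rewrite in_itv /= => /andP[ts s0]; apply: le_trans tr.
by rewrite (ler0_norm s0) (ltr0_norm t0) lerN2.
Qed.

(** The difference quotients on both sides are the same function of the increment. *)
Lemma derive_line (R : realType) (V : normedModType R) (f : V -> R) (y v : V)
    (s : R) :
  (derivable (fun t : R => f (t *: v + y)) s 1 <-> derivable f (s *: v + y) v) /\
  'D_1 (fun t : R => f (t *: v + y)) s = 'D_v f (s *: v + y).
Proof.
have E :
    (fun h : R => h^-1 *: (f ((h *: (1 : R) + s) *: v + y) - f (s *: v + y)))
       = (fun h : R => h^-1 *: (f (h *: v + (s *: v + y)) - f (s *: v + y))).
  by apply/funext => h; rewrite [h *: (1 : R)]mulr1 scalerDl addrA.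
by rewrite /derivable /derive E.
Qed.

Lemma differentiable_partials (R : realType) (n : nat) (f : 'rV[R]_n -> R)
    (x : 'rV[R]_n) :
  (forall i, \forall y \near x, derivable f y (delta_mx 0 i)) ->
  (forall i, {for x, continuous ('D_(delta_mx 0 i) f)}) ->
  differentiable f x.
Proof.
move=> df cdf.
pose a i := 'D_(delta_mx 0 i) f x.
pose l (h : 'rV[R]_n) : R := \sum_i h 0 i * a i.
have l_lin : linear l.
  move=> k u v; rewrite /l scaler_sumr -big_split /=; apply: eq_bigr => i _.
  by rewrite !mxE mulrDl -mulrA.
pose lM := GRing.isLinear.Build _ _ _ _ _ l_lin.
pose lL : {linear 'rV[R]_n -> R} := HB.pack l lM.
have l_cont : continuous lL.
  move=> h; apply: differentiable_continuous.
  rewrite (_ : (lL : _ -> R) = \sum_i (fun h : 'rV[R]_n => h 0 i *: a i)).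
    apply: differentiable_sum => i; apply: differentiableZl.
    exact: differentiable_coord.
  by apply/funext => k; rewrite fct_sumE.
(* This expansion both identifies the differential with [lL] and proves differentiability. *)
suff fo : f \o shift x = cst (f x) + (lL : _ -> R^o) +o_ (0 : 'rV[R]_n) id.
  by apply/diff_locallyP; rewrite (diff_unique l_cont fo).
apply/eqaddoP => _/posnumP[eps].
(* The [n] coordinate steps cost at most [e * |h|] each; [n.+1] keeps the quotient meaningful for
   [n = 0]. *)
pose e := eps%:num / n.+1%:R.
have e0 : 0 < e by rewrite divr_gt0.
pose good i := [set y | derivable f y (delta_mx 0 i) /\
  `|'D_(delta_mx 0 i) f y - a i| <= e].
have near_good i : nbhs x (good i).
  have /cvgrPdist_le/(_ _ e0) cdfe := cdf i.
  near=> y; rewrite /good /= distrC; split; near: y; [exact: df|exact: cdfe].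
have : nbhs x [set y | forall i, good i y].
  exact: (filter_forall (@nbhs_filter _ x) near_good).
move=> /nbhs_ballP[r /= r0 near_x].
rewrite nearE; apply/nbhs_ballP; exists r => //= h [_ h0r].
have hr j : `|h 0 j| < r by have := h0r 0 j; rewrite /ball /= mxE sub0r normrN.
(* [f (h + x) - f x] telescopes along the truncations of [h], so the mean     *)
(* value theorem is needed in one variable only.                              *)
pose tr k : 'rV[R]_n := \row_j (if (j < k)%N then h 0 j else 0).
have trS (k : 'I_n) : tr k.+1 = h 0 k *: delta_mx 0 k + tr k.
  apply/rowP => j; rewrite !mxE eqxx /= ltnS leq_eqVlt -val_eqE /=.
  case: eqP => [/val_inj ->|_]; last by rewrite mulr0 add0r.
  by rewrite ltnn mulr1 addr0.
have step (k : 'I_n) :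
    `|f (tr k.+1 + x) - f (tr k + x) - h 0 k * a k| <= e * `|h 0 k|.
  have := @mean_value_estimate R (fun t => f (t *: delta_mx 0 k + (tr k + x)))
    (a k) e `|h 0 k| _ (h 0 k) (lexx _).
  rewrite scale0r add0r trS addrA; apply => s sh.
  have [dl ->] := derive_line f (tr k + x) (delta_mx 0 k) s.
  (* The [j]-th coordinate of the moving point differs from that of [x] by [h 0 j], [s] or 0, so the
     point stays in the ball. *)
  rewrite dl; apply: near_x; split => // i j; rewrite ord1.
  rewrite /ball /= !mxE eqxx /= addrA opprD addrCA subrr addr0 normrN.
  rewrite -val_eqE /=.
  case: ltngtP => jk; rewrite ?mulr0 ?mulr1 ?addr0 ?add0r ?normr0 //.
  exact: le_lt_trans (hr k).
have tr0 : tr 0%N = 0 by apply/rowP => j; rewrite !mxE.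
have trn : tr n = h by apply/rowP => j; rewrite !mxE ltn_ord.
have -> : (f \o shift x - (cst (f x) + lL)) h =
    \sum_(k < n) (f (tr k.+1 + x) - f (tr k + x) - h 0 k * a k).
  rewrite sumrB -(big_mkord xpredT (fun k => f (tr k.+1 + x) - f (tr k + x))).
  rewrite telescope_sumr // trn tr0 add0r.
  by rewrite !fctE /= opprD addrA.
apply: le_trans (ler_norm_sum _ _ _) _.
apply: (@le_trans _ _ (\sum_(k < n) e * `|h|)).
  apply: ler_sum => k _; apply: le_trans (step k) _.
  rewrite ler_pM2l // [leRHS]/Num.Def.normr/= mx_normrE.
  exact: (le_bigmax _ _ (0, k)).
rewrite sumr_const card_ord -mulrnAl ler_wpM2r //.
by rewrite -mulr_natr /e -mulrA ler_piMr // mulrC ler_pdivrMr // mul1r ler_nat.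
Unshelve. all: by end_near. Qed.

Lemma derive_sum_partials (R : realType) (n : nat) (f : 'rV[R]_n -> R)
    (x w : 'rV[R]_n) : differentiable f x ->
  'D_w f x = \sum_i w 0 i * 'D_(delta_mx 0 i) f x.
Proof.
move=> df; rewrite deriveE // [in LHS](row_sum_delta w) linear_sum.
by apply: eq_bigr => i _; rewrite linearZ /= -deriveE.
Qed.

Lemma differentiable_row (R : realType) (n m : nat)
    (G : 'rV[R]_n -> 'rV[R]_m) (x : 'rV[R]_n) :
  (forall j, differentiable (fun y => G y 0 j) x) -> differentiable G x.
Proof.
move=> dG; rewrite (_ : G = \sum_j (fun y => G y 0 j *: delta_mx 0 j)).
  by apply: differentiable_sum => j; exact: differentiableZl.
by apply/funext => y; rewrite fct_sumE [LHS]row_sum_delta.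
Qed.

Lemma derive_comp_row (R : realType) (n m : nat) (G : 'rV[R]_n -> 'rV[R]_m)
    (f : 'rV[R]_m -> R) (x w : 'rV[R]_n) :
  (forall j, differentiable (fun y => G y 0 j) x) ->
  differentiable f (G x) ->
  'D_w (f \o G) x =
    \sum_j 'D_w (fun y => G y 0 j) x * 'D_(delta_mx 0 j) f (G x).
Proof.
move=> dGj df; have dG := differentiable_row dGj.
rewrite deriveE; last exact: differentiable_comp.
rewrite diff_comp //= -!deriveE // derive_sum_partials //.
by apply: eq_bigr => j _; rewrite derive_mx ?mxE //; exact: diff_derivable.
Qed.

(** * Closure properties of C^k functions on open sets *)

Section Ck_theory.
Context (R : realType) (n : nat).
Implicit Types (k : nat) (U V : set 'rV[R]_n) (f g : 'rV[R]_n -> R).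

Lemma Ck_continuous k V f x : Ck k V f -> V x -> {for x, continuous f}.
Proof. by case: k => [|k] [+ _] => /[apply]. Qed.

Lemma Ck_sub k U V f : U `<=` V -> Ck k V f -> Ck k U f.
Proof.
move=> UV; elim: k f => [|k IH] f [cf df]; split=> //.
- by move=> x /UV /cf.
- by move=> x /UV /cf.
move=> i; have [dfi Dfi] := df i.
by split; [move=> x /UV /dfi|exact: IH].
Qed.

Lemma Ck_pred k V f : Ck k.+1 V f -> Ck k V f.
Proof.
elim: k f => [|k IH] f [cf df]; split=> // i.
by have [dfi Dfi] := df i; split=> //; exact: IH.
Qed.

Lemma near_eq_continuous f g (x : 'rV[R]_n) :
  {near x, f =1 g} -> {for x, continuous f} -> {for x, continuous g}.
Proof.
move=> fg; rewrite /prop_for /continuous_at -(nbhs_singleton fg).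
exact: cvg_trans (near_eq_cvg fg).
Qed.

(** As [V] is open, equality on [V] is equality near each of its points, so the partial derivatives
    agree on [V] too. *)
Lemma Ck_eq k V f g : open V -> {in V, f =1 g} -> Ck k V f -> Ck k V g.
Proof.
move=> oV.
have near_fg f' g' x : {in V, f' =1 g'} -> V x -> {near x, f' =1 g'}.
  move=> fg Vx; have nV : nbhs x V by exact: open_nbhs_nbhs.
  by apply: filterS nV => y Vy; apply: fg; rewrite inE.
elim: k f g => [|k IH] f g fg [cf df].
all: split=> //; try by move=> x Vx; apply: near_eq_continuous (cf x Vx);
  exact: near_fg.
move=> i; have [dfi Dfi] := df i; split.
  by move=> x Vx; apply: near_eq_derivable (dfi x Vx); exact: near_fg.
apply: IH Dfi => x; rewrite inE => Vx; apply: near_eq_derive; exact: near_fg.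
Qed.

Lemma Ck_cst k V (a : R) : Ck k V (fun=> a).
Proof.
elim: k a => [|k IH] a; split=> //; try by move=> x _; exact: cst_continuous.
move=> i.
split=> [x _|]; first exact: derivable_cst.
have E : (fun x : 'rV[R]_n => 'D_(delta_mx 0 i) (fun=> a) x) = (fun=> 0).
  by apply/funext => x; exact: derive_cst.
by rewrite E.
Qed.

Lemma CkD k V f g : open V ->
  Ck k V f -> Ck k V g -> Ck k V (fun x => f x + g x).
Proof.
move=> oV; elim: k f g => [|k IH] f g [cf df] [cg dg].
all: split=> //; try by move=> x Vx; apply: continuousD; [exact: cf|exact: cg].
move=> i; have [dfi Dfi] := df i; have [dgi Dgi] := dg i.
split=> [x Vx|]; first by apply: derivableD; [exact: dfi|exact: dgi].
apply: Ck_eq (IH _ _ Dfi Dgi) => // x; rewrite inE => Vx.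
by rewrite deriveD //; [exact: dfi|exact: dgi].
Qed.

Lemma CkM k V f g : open V ->
  Ck k V f -> Ck k V g -> Ck k V (fun x => f x * g x).
Proof.
move=> oV; elim: k f g => [|k IH] f g Cf Cg.
all: have [cf df] := Cf; have [cg dg] := Cg.
all: split=> //; try by move=> x Vx; apply: continuousM; [exact: cf|exact: cg].
move=> i; have [dfi Dfi] := df i; have [dgi Dgi] := dg i.
split=> [x Vx|]; first by apply: derivableM; [exact: dfi|exact: dgi].
have := CkD oV (IH _ _ (Ck_pred Cf) Dgi) (IH _ _ (Ck_pred Cg) Dfi).
apply: Ck_eq => // x; rewrite inE => Vx.
by rewrite deriveM //; [exact: dfi|exact: dgi].
Qed.

Lemma Ck_sum k V I (s : seq I) (F : I -> 'rV[R]_n -> R) : open V ->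
  (forall i, Ck k V (F i)) -> Ck k V (fun x => \sum_(i <- s) F i x).
Proof.
move=> oV CF; elim: s => [|i s IH].
  by rewrite (_ : (fun x => _) = fun=> 0); [exact: Ck_cst|
    apply/funext => x; rewrite big_nil].
rewrite (_ : (fun x => _) = fun x => F i x + \sum_(j <- s) F j x).
  exact: CkD.
by apply/funext => x; rewrite big_cons.
Qed.

Lemma C1_differentiable V f x : open V -> V x -> Ck 1 V f -> differentiable f x.
Proof.
move=> oV Vx [cf df]; apply: differentiable_partials => i;
  have [dfi [Dfi _]] := df i.
  by have nV : nbhs x V by [exact: open_nbhs_nbhs]; apply: filterS nV => y /dfi.
exact: Dfi.
Qed.

End Ck_theory.

(** By the chain rule, a partial derivative of the composite is a sum of products to which the
    induction applies. [G] is C^l for every [l], so the induction runs on the order of [f] alone. *)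
Lemma Ck_comp (R : realType) (n m k : nat) (V : set 'rV[R]_n)
    (W : set 'rV[R]_m) (G : 'rV[R]_n -> 'rV[R]_m) (f : 'rV[R]_m -> R) :
  open V -> open W -> (forall l j, Ck l V (fun x => G x 0 j)) ->
  (forall x, V x -> W (G x)) -> Ck k W f -> Ck k V (f \o G).
Proof.
move=> oV oW CG VW.
have dGj x : V x -> forall j, differentiable (fun x => G x 0 j) x.
  by move=> Vx j; exact: C1_differentiable (CG 1%N j).
have cG x : V x -> {for x, continuous G}.
  by move=> Vx; exact/differentiable_continuous/differentiable_row/dGj.
have cfG l g x : Ck l W g -> V x -> {for x, continuous (g \o G)}.
  move=> Cg Vx; apply: continuous_comp; first exact: cG.
  by apply: Ck_continuous Cg _; exact: VW.
elim: k f => [|k IH] f Cf; split=> //; try by move=> x; exact: (cfG _ _ _ Cf).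
have df x : V x -> differentiable f (G x).
  move=> Vx; apply: C1_differentiable (VW _ Vx) _ => //.
  by move: Cf; elim: (k) => // l IHl /Ck_pred.
have [_ dCf] := Cf.
move=> i; split=> [x Vx|].
  apply/diff_derivable/differentiable_comp; last exact: df.
  exact/differentiable_row/dGj.
apply: (@Ck_eq _ _ _ _ (fun x => \sum_j 'D_(delta_mx 0 i) (fun y => G y 0 j) x *
    ('D_(delta_mx 0 j) f \o G) x)) => // [x|].
  by rewrite inE => Vx; rewrite derive_comp_row //; [exact: dGj|exact: df].
apply: Ck_sum => // j; apply: CkM => //.
  by have [_ /(_ i)[_]] := CG k.+1 j.
by apply: IH; have [] := dCf j.
Qed.

(** * Smoothness at a point of R^n *)

Section SmoothAt.
Context (R : realType) (n : nat).
Implicit Types (x : 'rV[R]_n) (f g : 'rV[R]_n -> R).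

Lemma smooth_at_near x f : smooth_at x f -> \forall y \near x, smooth_at y f.
Proof.
move=> [V [oV Vx] CV]; have nV : nbhs x V by exact: open_nbhs_nbhs.
by apply: filterS nV => y Vy; exists V.
Qed.

Lemma near_eq_smooth_at x f g :
  {near x, f =1 g} -> smooth_at x f -> smooth_at x g.
Proof.
move=> nfg [V [oV Vx] Cf].
have : nbhs x [set y | f y = g y] by exact: nfg.
rewrite nbhsE => -[U [oU Ux] fg].
exists (U `&` V) => [|k]; first by split; [exact: openI|].
apply: (@Ck_eq _ _ _ _ f); first exact: openI.
  by move=> y; rewrite inE => -[/fg].
by apply: Ck_sub (Cf k) => y [].
Qed.

Lemma smooth_at_differentiable x f : smooth_at x f -> differentiable f x.
Proof. by move=> [V [oV Vx] Cf]; exact: C1_differentiable (Cf 1%N). Qed.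

Lemma smooth_at_partial x f (i : 'I_n) :
  smooth_at x f -> smooth_at x (fun y => 'D_(delta_mx 0 i) f y).
Proof.
by move=> [V nV Cf]; exists V => // k; have [_ /(_ i)[]] := Cf k.+1.
Qed.

Lemma smooth_at_cst x (a : R) : smooth_at x (fun=> a).
Proof. by exists setT => [|k]; [split=> //; exact: openT|exact: Ck_cst]. Qed.

Lemma smooth_atD x f g :
  smooth_at x f -> smooth_at x g -> smooth_at x (fun y => f y + g y).
Proof.
move=> [V [oV Vx] Cf] [W [oW Wx] Cg].
exists (V `&` W) => [|k]; first by split; [exact: openI|].
apply: CkD; first exact: openI.
  by apply: Ck_sub (Cf k) => y [].
by apply: Ck_sub (Cg k) => y [].
Qed.

Lemma smooth_atM x f g :
  smooth_at x f -> smooth_at x g -> smooth_at x (fun y => f y * g y).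
Proof.
move=> [V [oV Vx] Cf] [W [oW Wx] Cg].
exists (V `&` W) => [|k]; first by split; [exact: openI|].
apply: CkM; first exact: openI.
  by apply: Ck_sub (Cf k) => y [].
by apply: Ck_sub (Cg k) => y [].
Qed.

End SmoothAt.

Lemma smooth_at_comp (R : realType) (n m : nat) (G : 'rV[R]_n -> 'rV[R]_m)
    (f : 'rV[R]_m -> R) (x : 'rV[R]_n) :
  (forall j, smooth_at x (fun y => G y 0 j)) -> smooth_at (G x) f ->
  smooth_at x (f \o G).
Proof.
move=> sG [W [oW Wx] Cf].
have cG : {for x, continuous G}.
  apply/differentiable_continuous/differentiable_row => j.
  exact: smooth_at_differentiable.
have nW : nbhs x (G @^-1` W) by apply: cG; exact: open_nbhs_nbhs.
have /choice[V VP] : forall j, exists V,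
    open_nbhs x V /\ forall k, Ck k V (fun y => G y 0 j).
  by move=> j; have [V] := sG j; exists V.
have nV : nbhs x [set y | forall j, V j y].
  apply: (filter_forall (@nbhs_filter _ x)) => j.
  by apply: open_nbhs_nbhs; have [] := VP j.
have : nbhs x (G @^-1` W `&` [set y | forall j, V j y]) by exact: filterI.
rewrite nbhsE => -[U oU UVW]; exists U => // k.
apply: Ck_comp oW _ _ (Cf k); first by case: oU.
  move=> l j; have [_ CV] := VP j; apply: Ck_sub (CV l) => y Uy.
  by have [_] := UVW _ Uy; exact.
by move=> y /UVW[].
Qed.

(** * Smooth functions and tangent vectors on manifolds *)

Section SmoothNear.
Context (R : realType) (n : nat) (M : manifold R n).
Implicit Types (p q : M) (f g : M -> R) (c d : chart R n M).

Lemma near_chart c p (P : M -> Prop) : cdom c p ->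
  (\forall q \near p, P q) -> \forall x \near cmap c p, P (cinv c x).
Proof.
move=> cp nP; have := @cinv_continuous _ _ _ c _ (cmap_img cp).
by rewrite /prop_for /continuous_at (cmapK cp); exact.
Qed.

Lemma near_chartV c p (P : 'rV[R]_n -> Prop) : cdom c p ->
  (\forall x \near cmap c p, P x) -> \forall q \near p, P (cmap c q).
Proof. by move=> cp; exact: cmap_continuous cp _. Qed.

Lemma near_cdom c p : cdom c p -> \forall q \near p, cdom c q.
Proof. by move=> cp; apply: open_nbhs_nbhs; split=> //; exact: cdom_open. Qed.

Lemma near_cimg c p : cdom c p -> \forall x \near cmap c p, cimg c x.
Proof.
by move=> cp; apply: open_nbhs_nbhs; split; [exact: cimg_open|exact: cmap_img].
Qed.

(** Transition maps are smooth, so one chart suffices to test smoothness. *)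
Lemma smooth_near_chart c p f : atlas c -> cdom c p ->
  smooth_at (cmap c p) (f \o cinv c) -> smooth_near p f.
Proof.
move=> ac cp sf d ad dp.
have : smooth_at (cmap d p) ((f \o cinv c) \o (cmap c \o cinv d)).
  apply: smooth_at_comp => [j|]; first exact: (atlas_smooth ad ac dp cp j).
  by rewrite /= (cmapK dp).
apply: near_eq_smooth_at; apply: filterS (near_chart dp (near_cdom cp)) => x cx.
by rewrite /= cmapK.
Qed.

Lemma near_eq_smooth_near p f g : (\forall q \near p, f q = g q) ->
  smooth_near p f -> smooth_near p g.
Proof.
move=> fg sf c ac cp; apply: near_eq_smooth_at (sf c ac cp).
exact: (near_chart cp fg).
Qed.

Lemma near_smooth_near p f :
  smooth_near p f -> \forall q \near p, smooth_near q f.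
Proof.
move=> sf; have [c ac cp] := atlas_cover p.
near=> q; have cq : cdom c q by near: q; exact: near_cdom.
apply: (smooth_near_chart ac cq).
near: q; apply: (near_chartV (P := fun x => smooth_at x (f \o cinv c))) => //.
exact/smooth_at_near/sf.
Unshelve. all: by end_near. Qed.

Lemma smooth_near_cst p (a : R) : smooth_near p (fun=> a).
Proof. by move=> c _ _; exact: smooth_at_cst. Qed.

Lemma smooth_nearD p f g :
  smooth_near p f -> smooth_near p g -> smooth_near p (fun q => f q + g q).
Proof. by move=> sf sg c ac cp; apply: smooth_atD; [exact: sf|exact: sg]. Qed.

Lemma smooth_nearM p f g :
  smooth_near p f -> smooth_near p g -> smooth_near p (fun q => f q * g q).
Proof. by move=> sf sg c ac cp; apply: smooth_atM; [exact: sf|exact: sg]. Qed.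

Definition chart_coord c (i : 'I_n) q : R := cmap c q 0 i.

Lemma smooth_chart_coord c p i :
  atlas c -> cdom c p -> smooth_near p (chart_coord c i).
Proof. by move=> ac cp d ad dp; exact: (atlas_smooth ad ac dp cp i). Qed.

End SmoothNear.

(** * Coordinate frames and tangent spaces *)

Section Tangent.
Context (R : realType) (n : nat) (M : manifold R n).
Implicit Types (p q : M) (f g : M -> R) (c d : chart R n M) (u v : tvec M).

(** Literally the derivation used in [tangent], so that tangency holds by unfolding. *)
Definition chart_vec c p (w : 'rV[R]_n) : tvec M := fun f =>
  if `[< smooth_near p f >] then 'D_w (f \o cinv c) (cmap c p) else 0.

Definition coord_field c (i : 'I_n) q : tvec M := chart_vec c q (delta_mx 0 i).

Lemma tvec_sumE (I : Type) (s : seq I) (a : I -> R) (e : I -> tvec M) f :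
  (\sum_(i <- s) a i *: e i) f = \sum_(i <- s) a i * e i f.
Proof. by rewrite fct_sumE. Qed.

Lemma chart_vecE c p w : atlas c -> cdom c p ->
  chart_vec c p w = \sum_i w 0 i *: coord_field c i p.
Proof.
move=> ac cp; apply/funext => f; rewrite tvec_sumE /coord_field /chart_vec.
(* On functions not smooth near [p] every term takes the default value 0. *)
case: asboolP => sf; last by rewrite big1 // => i _; rewrite mulr0.
exact/derive_sum_partials/smooth_at_differentiable/sf.
Qed.

Lemma tangent_sum_coord c p (a : 'I_n -> R) : atlas c -> cdom c p ->
  tangent p (\sum_i a i *: coord_field c i p).
Proof.
move=> ac cp; exists c; split=> //; exists (\row_i a i).
transitivity (chart_vec c p (\row_i a i)) => //.
by rewrite chart_vecE //; apply: eq_bigr => i _; rewrite mxE.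
Qed.

(** [v] may be given through another chart [d]; the chain rule for the transition map rewrites it in
    the frame of [c], with coefficients the derivatives of the coordinates of [c]. *)
Lemma tangent_coordE c p v : atlas c -> cdom c p -> tangent p v ->
  v = \sum_i v (chart_coord c i) *: coord_field c i p.
Proof.
move=> ac cp [d [ad dp [w ->]]]; apply/funext => f.
rewrite tvec_sumE /coord_field /chart_vec.
case: asboolP => sf; last by rewrite big1 // => i _; rewrite mulr0.
have -> : 'D_w (f \o cinv d) (cmap d p) =
    'D_w ((f \o cinv c) \o (cmap c \o cinv d)) (cmap d p).
  apply: near_eq_derive; apply: filterS (near_chart dp (near_cdom cp)) => x cx.
  by rewrite /= cmapK.
rewrite derive_comp_row; first last.
- by rewrite /= (cmapK dp); exact/smooth_at_differentiable/sf.
- move=> j; apply: smooth_at_differentiable.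
  exact: (atlas_smooth ad ac dp cp j).
apply: eq_bigr => i _; rewrite asboolT; last exact: smooth_chart_coord.
by rewrite /= (cmapK dp).
Qed.

(** The two vectors may come from different charts, so both are expanded in one coordinate frame. *)
Lemma tangent_linear p (a : R) u v :
  tangent p u -> tangent p v -> tangent p (a *: u + v).
Proof.
move=> tu tv; have [c ac cp] := atlas_cover p.
rewrite (tangent_coordE ac cp tu) (tangent_coordE ac cp tv).
rewrite scaler_sumr -big_split /=.
under eq_bigr do rewrite scalerA -scalerDl.
exact: tangent_sum_coord.
Qed.

Lemma tangent0 p : tangent p (0 : tvec M).
Proof.
have [c ac cp] := atlas_cover p.
have := tangent_sum_coord (fun=> 0) ac cp.
by rewrite big1 // => i _; rewrite scale0r.
Qed.

Lemma tangentD p u v : tangent p u -> tangent p v -> tangent p (u + v).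
Proof. by move=> tu tv; rewrite -[u]scale1r; exact: tangent_linear. Qed.

Lemma tangentZ p (a : R) u : tangent p u -> tangent p (a *: u).
Proof.
move=> tu; rewrite -[X in tangent p X]addr0.
exact: tangent_linear (tangent0 p).
Qed.

Lemma tangent_sum p (I : Type) (s : seq I) (a : I -> R) (e : I -> tvec M) :
  (forall i, tangent p (e i)) -> tangent p (\sum_(i <- s) a i *: e i).
Proof.
move=> te; elim: s => [|i s IH]; first by rewrite big_nil; exact: tangent0.
by rewrite big_cons; exact: tangent_linear.
Qed.

Lemma tangent_coord_field c p i : atlas c -> cdom c p ->
  tangent p (coord_field c i p).
Proof. by move=> ac cp; exists c; split=> //; exists (delta_mx 0 i). Qed.

Lemma tangent_near_eq p v f g : tangent p v ->
  (\forall q \near p, f q = g q) -> v f = v g.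
Proof.
move=> [c [ac cp [w ->]]] fg.
have gf : \forall q \near p, g q = f q by apply: filterS fg => q ->.
have -> : `[< smooth_near p f >] = `[< smooth_near p g >].
  by apply/asbool_equiv_eq; split; exact: near_eq_smooth_near.
case: ifP => // _; apply: near_eq_derive; exact: (near_chart cp fg).
Qed.

Lemma tangent_cst p v (a : R) : tangent p v -> v (fun=> a) = 0.
Proof. by move=> [c [ac cp [w ->]]]; case: ifP => // _; exact: derive_cst. Qed.

(** On a smooth [f] the field is a partial derivative in the chart; [f] is smooth near all points
    close to [p], so the default value 0 does not interfere there. *)
Lemma vfield_coord_field c p i : atlas c -> cdom c p ->
  vfield p (coord_field c i).
Proof.
move=> ac cp; split=> [|f sf].
  by apply: filterS (near_cdom cp) => q cq; exact: tangent_coord_field.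
apply: (smooth_near_chart ac cp).
apply: near_eq_smooth_at (smooth_at_partial i (sf c ac cp)).
near=> x; rewrite /= /coord_field /chart_vec asboolT.
  by rewrite cinvK //; near: x; exact: near_cimg.
near: x; apply: (near_chart (P := fun q => smooth_near q f)) => //.
exact: near_smooth_near.
Unshelve. all: by end_near. Qed.

End Tangent.

(** * Sections along a map and nearly Sasakian structures *)

Section LinearOnTangent.
Context (R : realType) (n : nat) (M : manifold R n) (p : M) (W : lmodType R).
Context (T : tvec M -> W).
Hypothesis T_linear : forall (a : R) u v, tangent p u -> tangent p v ->
  T (a *: u + v) = a *: T u + T v.

(** [phi], [eta] and [gbar] are linear only on tangent vectors inside the larger space [tvec], so
    the usual consequences of linearity are proved relative to tangency. *)
Lemma linear_on_tangent0 : T 0 = 0.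
Proof.
have := T_linear 1 (tangent0 p) (tangent0 p).
rewrite !scale1r addr0 => /(congr1 (fun w => w - T 0)).
by rewrite subrr addrK.
Qed.

Lemma linear_on_tangentD u v :
  tangent p u -> tangent p v -> T (u + v) = T u + T v.
Proof. by move=> tu tv; rewrite -[u]scale1r T_linear // !scale1r. Qed.

Lemma linear_on_tangentZ (a : R) u : tangent p u -> T (a *: u) = a *: T u.
Proof.
move=> tu; rewrite -[a *: u]addr0 T_linear //; last exact: tangent0.
by rewrite linear_on_tangent0 addr0.
Qed.

Lemma linear_on_tangent_sum (I : Type) (s : seq I) (a : I -> R)
    (e : I -> tvec M) : (forall i, tangent p (e i)) ->
  T (\sum_(i <- s) a i *: e i) = \sum_(i <- s) a i *: T (e i).
Proof.
move=> te; elim: s => [|i s IH]; first by rewrite !big_nil linear_on_tangent0.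
by rewrite !big_cons T_linear ?IH //; exact: tangent_sum.
Qed.

End LinearOnTangent.

Section SectionsAlong.
Context (R : realType) (n m : nat) (N : manifold R n) (M : manifold R m).
Context (F : M -> N).
Implicit Types (p q : M) (Y Z : M -> tvec N) (f : M -> R).

Lemma near_eq_section p Y Z :
  (\forall q \near p, Y q = Z q) -> section F p Y -> section F p Z.
Proof.
move=> YZ [tY sY]; split=> [|f sf].
  by apply: filterS2 YZ tY => q ->.
by apply: near_eq_smooth_near (sY f sf); apply: filterS YZ => q ->.
Qed.

Lemma section0 p : section F p (fun=> 0).
Proof.
split=> [|f _]; first by apply: nearW => q; exact: tangent0.
exact: smooth_near_cst.
Qed.

Lemma sectionD p Y Z :
  section F p Y -> section F p Z -> section F p (fun q => Y q + Z q).
Proof.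
move=> [tY sY] [tZ sZ]; split=> [|f sf].
  by apply: filterS2 tY tZ => q; exact: tangentD.
by apply: smooth_nearD; [exact: sY|exact: sZ].
Qed.

Lemma sectionZ p f Z :
  smooth_near p f -> section F p Z -> section F p (fun q => f q *: Z q).
Proof.
move=> sf [tZ sZ]; split=> [|g sg].
  by apply: filterS tZ => q; exact: tangentZ.
by apply: smooth_nearM => //; exact: sZ.
Qed.

Lemma section_sum p (I : Type) (s : seq I) (a : I -> M -> R)
    (E : I -> M -> tvec N) :
  (forall i, smooth_near p (a i)) -> (forall i, section F p (E i)) ->
  section F p (fun q => \sum_(i <- s) a i q *: E i q).
Proof.
move=> sa sE; elim: s => [|i s IH].
  by apply: near_eq_section (section0 p); apply: nearW => q; rewrite big_nil.
apply: near_eq_section (sectionD (sectionZ (sa i) (sE i)) IH).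
by apply: nearW => q; rewrite big_cons.
Qed.

Lemma section_pullback p (Y : N -> tvec N) :
  smooth_map F -> vfield (F p) Y -> section F p (fun q => Y (F q)).
Proof.
move=> sF [tY sY]; have [cF pF] := sF p; split=> [|f sf].
  exact: (cF _ tY).
exact: (pF (fun y => Y y f) (sY f sf)).
Qed.

Section Connection.
Context (D : M -> tvec M -> (M -> tvec N) -> tvec N).
Hypothesis conn : connection_along F D.

(* An indicator function is smooth at [p] as soon as it is 1 near [p], so the *)
(* Leibniz rule for germs alone makes [D] local.                              *)
Lemma conn_near_eq p v Y Z : tangent p v -> section F p Y ->
  (\forall q \near p, Y q = Z q) -> D p v Y = D p v Z.
Proof.
move=> tv sY YZ; have sZ := near_eq_section YZ sY.
pose f q : R := if `[< Y q = Z q >] then 1 else 0.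
have f1 : \forall q \near p, 1 = f q.
  by apply: filterS YZ => q Yq; rewrite /f asboolT.
have sf : smooth_near p f.
  by apply: near_eq_smooth_near f1 _; exact: smooth_near_cst.
have DfE X : section F p X -> D p v (fun q => f q *: X q) = D p v X.
  move=> sX; rewrite (conn_leibniz conn) //.
  rewrite -(tangent_near_eq tv f1) (tangent_cst _ tv) -(nbhs_singleton f1).
  by rewrite scale0r scale1r add0r.
(* Multiplied by [f], the two sections agree everywhere and not only near [p]. *)
rewrite -DfE // -[RHS]DfE //; congr (D p v _); apply/funext => q.
by rewrite /f; case: asboolP => [->|_] //; rewrite !scale0r.
Qed.

Lemma conn_sum p v (I : Type) (s : seq I) (a : I -> M -> R)
    (E : I -> M -> tvec N) : tangent p v ->
  (forall i, smooth_near p (a i)) -> (forall i, section F p (E i)) ->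
  D p v (fun q => \sum_(i <- s) a i q *: E i q) =
  \sum_(i <- s) (v (a i) *: E i p + a i p *: D p v (E i)).
Proof.
move=> tv sa sE; elim: s => [|i s IH].
  rewrite big_nil; under eq_fun do rewrite big_nil.
  have := conn_add conn tv (section0 p) (section0 p).
  under [X in D p v X]eq_fun do rewrite addr0.
  by move=> /(congr1 (fun w => w - D p v (fun=> 0))); rewrite subrr addrK.
rewrite big_cons -IH -(conn_leibniz conn tv (sa i) (sE i)).
rewrite -(conn_add conn) //; first last.
- exact: section_sum.
- exact: sectionZ.
by congr (D p v _); apply/funext => q; rewrite big_cons.
Qed.

End Connection.

End SectionsAlong.

(** * Pointwise identities and the structure equation on the ambient manifold *)

Section NearlySasakian.
Context (R : realType) (n : nat) (Mb : nearly_sasakian R n).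
Implicit Types (p : Mb) (u v : tvec Mb).

Lemma tangent_xi p : tangent p (xi Mb p).
Proof. by have [/nbhs_singleton] := xi_smooth p. Qed.

Lemma gbar_linear p w : tangent p w -> forall (a : R) u v,
  tangent p u -> tangent p v ->
  gbar Mb p (a *: u + v) w = a *: (gbar Mb p u w : R^o) + gbar Mb p v w.
Proof. by move=> tw a u v tu tv; exact: (metric_linear (gbar_metric Mb)). Qed.

Lemma eta_scaler_linear p (a : R) u v : tangent p u -> tangent p v ->
  eta Mb p (a *: u + v) = a *: (eta Mb p u : R^o) + eta Mb p v.
Proof. by move=> tu tv; exact: eta_linear. Qed.

(** Metric compatibility for [v] and [xi]: the left side vanishes because [phi] kills [xi]. *)
Lemma etaE p v : tangent p v -> eta Mb p v = gbar Mb p v (xi Mb p).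
Proof.
move=> tv.
have := gbar_phi tv (tangent_xi p); rewrite phi_xi eta_xi mulr1.
rewrite (metric_sym (gbar_metric Mb)); first last.
- exact: tangent0.
- exact: phi_tangent.
rewrite (linear_on_tangent0 (gbar_linear (phi_tangent tv))).
by move/eqP; rewrite eq_sym subr_eq0 => /eqP.
Qed.

(** Compatibility gives g(u, phi u) = g(phi u, phi^2 u) = - g(phi u, u), so symmetry forces zero. *)
Lemma gbar_phi_self p u : tangent p u -> eta Mb p u = 0 ->
  gbar Mb p u (phi Mb p u) = 0.
Proof.
move=> tu eu; have tphi := phi_tangent tu.
have := gbar_phi tu tphi; rewrite eu mul0r subr0 phi_sqr // eu scale0r addr0.
rewrite -scaleN1r (metric_sym (gbar_metric Mb)) //; last exact: tangentZ.
rewrite (linear_on_tangentZ (gbar_linear tphi)) // scaleN1r => /eqP.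
by rewrite eq_sym -subr_eq0 opprK -mulr2n mulrn_eq0 => /eqP.
Qed.

(** The structure equation on the diagonal, under [eta]: the term phi(nabla_U U) drops out because
    [eta] vanishes on the image of [phi]. *)
Lemma eta_nabbar_phi p (U : Mb -> tvec Mb) : vfield p U ->
  eta Mb p (nabbar Mb p (U p) (fun q => phi Mb q (U q))) =
  gbar Mb p (U p) (U p) - eta Mb p (U p) ^+ 2.
Proof.
move=> vU; have tU : tangent p (U p) by have [/nbhs_singleton] := vU.
have conn := lc_connection (nabbar_levi_civita Mb).
have tA : tangent p (nabbar Mb p (U p) (fun q => phi Mb q (U q))).
  by apply: (conn_tangent conn) => //; exact: phi_smooth.
have tB : tangent p (phi Mb p (nabbar Mb p (U p) U)).
  by apply: phi_tangent; exact: (conn_tangent conn).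
have eta_lin := @eta_scaler_linear p.
have etaZ a u : tangent p u -> eta Mb p (a *: u) = a * eta Mb p u.
  exact: (linear_on_tangentZ eta_lin).
have tN u : tangent p u -> tangent p (- u).
  by move=> tu; rewrite -scaleN1r; exact: tangentZ.
have etaB u v : tangent p u -> tangent p v ->
    eta Mb p (u - v) = eta Mb p u - eta Mb p v.
  move=> tu tv; rewrite (linear_on_tangentD eta_lin) //; last exact: tN.
  by rewrite -scaleN1r etaZ // mulN1r.
have etaD := linear_on_tangentD eta_lin.
have /(congr1 (eta Mb p)) := nearly_sasakian_eq vU vU.
have tx := tangent_xi p.
have tAB := tangentD tA (tN _ tB).
rewrite etaD // etaB // eta_phi; last exact: (conn_tangent conn).
rewrite subr0 !etaB //; try exact: tangentZ.
  rewrite !etaZ // eta_xi; set A := eta Mb p _; set g := gbar _ _ _ _.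
  by rewrite expr2 => H; lra.
by apply: tangentD; [exact: tangentZ|apply/tN/tangentZ].
Qed.

End NearlySasakian.

(** * The tensor [phi] on sections along a map *)

Section PhiAlong.
Context (R : realType) (n m : nat) (Mb : nearly_sasakian R n).
Context (M : manifold R m) (F : M -> Mb).
Implicit Types (p : M) (c : chart R (2 * n + 1) Mb).

Lemma phi_sum_coord c (y : Mb) (b : 'I_(2 * n + 1) -> R) :
  atlas c -> cdom c y ->
  phi Mb y (\sum_i b i *: coord_field c i y) =
  \sum_i b i *: phi Mb y (coord_field c i y).
Proof.
move=> ac cy; apply: (linear_on_tangent_sum (p := y)).
  by move=> k u w; exact: phi_linear.
by move=> i; exact: tangent_coord_field.
Qed.

Hypothesis F_smooth : smooth_map F.

Lemma section_phi_coord_field c p i : atlas c -> cdom c (F p) ->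
  section F p (fun q => phi Mb (F q) (coord_field c i (F q))).
Proof.
move=> ac cp; have vphi := phi_smooth (vfield_coord_field i ac cp).
exact: section_pullback F_smooth vphi.
Qed.

Lemma near_phi_coordE c p X : atlas c -> cdom c (F p) -> section F p X ->
  \forall q \near p,
    \sum_i X q (chart_coord c i) *: phi Mb (F q) (coord_field c i (F q)) =
    phi Mb (F q) (X q).
Proof.
move=> ac cp [tX _]; have [cF _] := F_smooth p.
have near_c : \forall q \near p, cdom c (F q) := cF _ (near_cdom cp).
apply: filterS2 near_c tX => q cq tXq.
by rewrite [in RHS](tangent_coordE ac cq tXq) phi_sum_coord.
Qed.

(** [phi_smooth] concerns ambient fields only, so [X] is expanded with coefficients on M and each
    [phi] of a coordinate field is pulled back. *)
Lemma section_phi p X : section F p X ->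
  section F p (fun q => phi Mb (F q) (X q)).
Proof.
move=> sX; have [c ac cp] := atlas_cover (F p).
apply: near_eq_section (near_phi_coordE ac cp sX) _.
apply: section_sum => i; last exact: section_phi_coord_field.
by have [_] := sX; apply; exact: smooth_chart_coord.
Qed.

End PhiAlong.

(** * Transfer to the submanifold and nullity of [D0] *)

Section AlongSubmanifold.
Context (R : realType) (n : nat) (Mb : nearly_sasakian R n).
Context (M : lightlike_submanifold Mb).

(* [X] need not extend to an ambient vector field, so it is compared with the *)
(* ambient field [U] having constant coefficients in a chart: the terms       *)
(* [v (a i) *: phi e_i] that distinguish the two derivatives are killed by    *)
(* [eta].                                                                     *)
Lemma eta_nabbarM_phi (p : M) v X : tangent p v ->
  section (incl M) p X -> push (incl M) p v = X p ->
  eta Mb (incl M p) (nabbarM p v (fun q => phi Mb (incl M q) (X q))) =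
  gbar Mb (incl M p) (X p) (X p) - eta Mb (incl M p) (X p) ^+ 2.
Proof.
move=> tv sX pv; have sF : smooth_map (incl M) by have [] := incl_immersion M.
have conn := nabbarM_connection M.
have [c ac cp] := atlas_cover (incl M p).
pose e := coord_field c; pose a i q := X q (chart_coord c i).
have sa i : smooth_near p (a i).
  by have [_] := sX; apply; exact: smooth_chart_coord.
have sphi i := section_phi_coord_field sF i ac cp.
have near_c : \forall q \near p, cdom c (incl M q).
  by have [cF _] := sF p; exact: cF _ (near_cdom cp).
pose U y := \sum_i a i p *: e i y.
have vU : vfield (incl M p) U.
  by apply: section_sum => i; [exact: smooth_near_cst|exact: vfield_coord_field].
have UX : U (incl M p) = X p.
  by apply/esym/(tangent_coordE ac cp); have [/nbhs_singleton] := sX.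
have phiXE := near_phi_coordE sF ac cp sX.
have phiUE : \forall q \near p,
    \sum_i a i p *: phi Mb (incl M q) (e i (incl M q)) =
    phi Mb (incl M q) (U (incl M q)).
  by apply: filterS near_c => q cq; rewrite phi_sum_coord.
have sUM : section (incl M) p
    (fun q => \sum_i a i p *: phi Mb (incl M q) (e i (incl M q))).
  apply: (@section_sum _ _ _ _ _ _ _ _ _ (fun i _ => a i p)) => // i.
  exact: smooth_near_cst.
have := eta_nabbar_phi vU; rewrite UX => <-.
rewrite -pv -(nabbarM_pullback tv (phi_smooth vU)).
rewrite -(conn_near_eq conn tv _ phiXE); last exact: section_sum.
rewrite -(conn_near_eq conn tv _ phiUE) //.
rewrite !(conn_sum conn _ tv) //; last by move=> i; exact: smooth_near_cst.
have tphi i : tangent (incl M p) (phi Mb (incl M p) (e i (incl M p))).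
  exact/phi_tangent/tangent_coord_field.
have tD i : tangent (incl M p)
    (nabbarM p v (fun q => phi Mb (incl M q) (e i (incl M q)))).
  exact: (conn_tangent conn).
have eta_lin := @eta_scaler_linear _ _ Mb (incl M p).
(* The coefficients of [U] are constant, so [v] annihilates them. *)
under [in RHS]eq_bigr do rewrite (tangent_cst _ tv) scale0r add0r.
rewrite big_split /= (linear_on_tangentD eta_lin); try exact: tangent_sum.
rewrite (linear_on_tangent_sum eta_lin) //.
rewrite big1 ?add0r // => i _; rewrite eta_phi ?scaler0 //.
exact: tangent_coord_field.
Qed.

Lemma qgcr_D0_null (Q : qgcr M) (p : M) X : xi_normal M ->
  totally_umbilical M \/ totally_geodesic M ->
  section_of (incl M) (D0 Q) p X ->
  gbar Mb (incl M p) (X p) (X p) = 0.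
Proof.
move=> xiN Mumb [sX D0X].
have D0_TM q u : D0 Q q u -> TMb (incl M) q u.
  move=> D0u; have [-> Rad0] := screen_compl (l := M) q.
  (* The radical meets the screen in exactly 0, hence contains 0, which is the radical component of
     [u]. *)
  have [Rad00 _] : (Rad (gbar Mb) (incl M) q `&` screen M q) 0 by rewrite Rad0.
  by exists 0, u; rewrite add0r; split=> //; exact: qgcr_D0_sub D0u.
have D0Xp := nbhs_singleton D0X.
have tXp : tangent (incl M p) (X p) by have [/nbhs_singleton] := sX.
have [v tv pv] := D0_TM _ _ D0Xp.
have eta_TM u : tangent (incl M p) u -> TMb (incl M) p u ->
    eta Mb (incl M p) u = 0.
  by move=> tu TMu; rewrite etaE //; have [_] := xiN p; exact.
have etaX := eta_TM _ tXp (D0_TM _ _ D0Xp).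
have sF : smooth_map (incl M) by have [] := incl_immersion M.
pose phiX q := phi Mb (incl M q) (X q).
have sphiX : section (incl M) p phiX by exact: section_phi.
have TMphiX : section_of (incl M) (TMb (incl M)) p phiX.
  split=> //; apply: filterS D0X => q D0Xq; apply: D0_TM.
  by apply: (@qgcr_phiD0 _ _ _ _ Q q); exists (X q).
have [TMnabla _ nabbarE] := gauss tv TMphiX.
(* In the umbilical case the coefficient of [H] is g(X, phi X). *)
have sff0 : sff M p v phiX = 0.
  case: Mumb => [[H [_ ->]]|->] //.
  by rewrite pv gbar_phi_self // scale0r.
have := eta_nabbarM_phi tv sX pv; rewrite etaX expr0n subr0 => <-.
apply: eta_TM; first exact: (conn_tangent (nabbarM_connection M)).
by rewrite nabbarE sff0 addr0.
Qed.

End AlongSubmanifold.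

Theorem corollary4p5 (R : realType) (n : nat) (Mb : nearly_sasakian R n) :
  ~ exists (M : lightlike_submanifold Mb) (Q : qgcr M),
      [/\ qgcr_proper Q, xi_normal M & totally_umbilical M \/ totally_geodesic M].
Proof.
move=> [M [Q [[[p [u [D0u u0]]] _ _ _] xiN Mumb]]]; apply: u0.
have [[[k /(_ p)[E [sE frameE]]] _ _ _] _] := qgcr_subbundles Q.
have D0E := (nbhs_singleton frameE).2.
(* A vector of [D0] at [p] extends with constant coefficients in a local frame, so nullity of
   sections becomes nullity of vectors. *)
have D0_section w : D0 Q p w ->
    exists2 X, section_of (incl M) (D0 Q) p X & X p = w.
  rewrite D0E => -[a ->]; exists (fun q => \sum_i a i *: E i q) => //; split.
    by apply: section_sum => i //; exact: smooth_near_cst.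
  by apply: filterS frameE => q [_ ->]; exists a.
have D0_tangent w : D0 Q p w -> tangent (incl M p) w.
  by move=> /D0_section[X [[/nbhs_singleton + _] _] <-].
have D0_null w : D0 Q p w -> gbar Mb (incl M p) w w = 0.
  by move=> /D0_section[X sX <-]; exact: qgcr_D0_null xiN Mumb sX.
have D0_add w w' : D0 Q p w -> D0 Q p w' -> D0 Q p (w + w').
  rewrite D0E => -[a ->] [b ->]; exists (fun i => a i + b i).
  by rewrite -big_split; apply: eq_bigr => i _; rewrite scalerDl.
apply: (@qgcr_D0_nondegenerate _ _ _ _ Q p) => // w D0w.
have gbM := gbar_metric Mb.
have gD x y z (tz : tangent (incl M p) z) :=
  @linear_on_tangentD _ _ _ _ _ _ (gbar_linear tz) x y.
have tu := D0_tangent _ D0u; have tw := D0_tangent _ D0w.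
have tuw := tangentD tu tw.
(* Polarization: since [u], [w] and [u + w] are null, 2 g(u, w) = 0. *)
have := D0_null _ (D0_add _ _ D0u D0w).
rewrite gD // !(metric_sym gbM _ tuw) // !gD // !D0_null //.
rewrite add0r addr0 (metric_sym gbM tw tu) => /eqP.
by rewrite -mulr2n mulrn_eq0 => /eqP.
Qed.
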